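(* Let $G$ be a simple graph with vertex set $\{1,\ldots,n\}$, and let $\boldsymbol b=(b_1,\ldots,b_n)\in\mathbb R^n$ be such that $\sum_{j=1}^n b_j=0$ and $$\sum_{j\in U}b_j\le|\partial_G U|\qquad\text{for every }U\subseteq V(G),$$ with the inequality being strict for any $U$ that is not a union of connected components of $G$. Then there exists a vector $\boldsymbol r=(r_1,\ldots,r_n)$ of positive real numbers, unique up to uniform scaling in each connected component of $G$, such that the random orientation of $G$ with parameters $\lambda_{jk}=\frac{r_j}{r_j+r_k}$ ($jk\in G$) has expected imbalance sequence $\boldsymbol b$.
   Context: $\partial_G U$ is the set of edges of $G$ with exactly one end in $U$; $jk\in G$ means $jk$ is an edge of $G$. Given numbers $p_{jk},p_{kj}\in[0,1]$ with $p_{jk}+p_{kj}=1$ for each edge $jk$, the random orientation of $G$ with parameters $\{p_{jk}\}$ orients each edge $jk$ independently, towards $k$ (from $j$ to $k$) with probability $p_{jk}$ and towards $j$ with probability $p_{kj}$. The imbalance of a vertex is its out-degree minus its in-degree; thus the expected imbalance of $j$ is $\sum_{k:jk\in G}(p_{jk}-p_{kj})$. *)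

(* Defs.v *)
From HB Require Import structures.
From mathcomp Require Import all_boot all_order all_algebra.
From mathcomp Require Import reals.

Set Implicit Arguments.
Unset Strict Implicit.
Unset Printing Implicit Defensive.

Import Order.TTheory GRing.Theory Num.Theory.

Local Open Scope ring_scope.

(* A simple graph on V is given by its adjacency relation
   G : rel V, which is required to be symmetric and irreflexive wherever it is
   used; edges are the two-element sets of adjacent vertices. *)
Definition edges (V : finType) (G : rel V) : {set {set V}} :=
  [set [set a.1; a.2] | a : V * V & G a.1 a.2].

Definition boundary (V : finType) (G : rel V) (U : {set V}) : {set {set V}} :=
  [set f in edges G | #|f :&: U| == 1%N].

Definition component (V : finType) (G : rel V) (j : V) : {set V} :=
  [set k | connect G j k].

Definition components (V : finType) (G : rel V) : {set {set V}} :=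
  [set component G j | j : V].

(* The empty union is allowed, so set0 is a union of components. *)
Definition union_of_components (V : finType) (G : rel V) (U : {set V}) : Prop :=
  exists2 S : {set {set V}}, S \subset components G & U = cover S.

(* An orientation is encoded as its set of arcs; (j, k) is the edge jk oriented
   from j towards k. *)
Definition orientation (V : finType) (G : rel V) (D : {set V * V}) : bool :=
  [forall a in D, G a.1 a.2] &&
  [forall j, forall k, G j k ==> ((j, k) \in D) (+) ((k, j) \in D)].

Definition outdeg (V : finType) (D : {set V * V}) (j : V) : nat :=
  #|[set k | (j, k) \in D]|.

Definition indeg (V : finType) (D : {set V * V}) (j : V) : nat :=
  #|[set k | (k, j) \in D]|.

Definition imbalance (V : finType) (D : {set V * V}) (j : V) : int :=
  (outdeg D j)%:Z - (indeg D j)%:Z.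

(* Law of the random orientation with parameters p, where p j k is the
   probability that the edge jk is oriented from j towards k: since edges are
   oriented independently, an orientation has the product of the probabilities
   of its arcs.  This is a probability law when, for every edge jk, p j k and
   p k j are nonnegative and p j k + p k j = 1. *)
Definition orientation_prob (R : realType) (V : finType) (G : rel V)
    (p : V -> V -> R) (D : {set V * V}) : R :=
  if orientation G D then \prod_(a in D) p a.1 a.2 else 0.

Definition expected_imbalance (R : realType) (V : finType) (G : rel V)
    (p : V -> V -> R) (j : V) : R :=
  \sum_(D : {set V * V}) orientation_prob G p D * (imbalance D j)%:~R.

Definition lambda (R : realType) (n : nat) (r : 'rV[R]_n) (j k : 'I_n) : R :=
  r 0 j / (r 0 j + r 0 k).

Definition realizes (R : realType) (n : nat) (G : rel 'I_n)
    (b r : 'rV[R]_n) : Prop :=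
  (forall j, 0 < r 0 j) /\
  (forall j, expected_imbalance G (lambda r) j = b 0 j).

(* Main.v *)
(* In terms of r, the expected imbalance of j is the flow out of j, the sum of
   (r_j - r_k) / (r_j + r_k) over the neighbours k of j, which increases with
   r_j and decreases with every other r_k.

   Existence is Perron's method: in a box [1, M]^V, the pointwise supremum r of
   the vectors whose flow is at most b_j at every j with 1 < r_j belongs to this
   class, and has flow at least b_j wherever r_j < M.  If r < M, or if 1 < r, on
   a whole component, then flow and b agree there since both have sum 0.
   Otherwise, for M = T^(|V|+1), the values of r on the component avoid some
   interval (T^i, T^(i+1)); each edge leaving the set U of the vertices above
   this gap carries a flow close to 1, so that the sum of b over U is at least
   about |boundary U|, against strictness of the cut condition if T is large.

   Uniqueness is the maximum principle for the ratio of two solutions. *)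
Require Import Defs.
From HB Require Import structures.
From mathcomp Require Import all_boot all_order all_algebra.
From mathcomp Require Import reals.
From mathcomp Require Import ring lra.

Set Implicit Arguments.
Unset Strict Implicit.
Unset Printing Implicit Defensive.

Import Order.TTheory GRing.Theory Num.Theory.

Local Open Scope ring_scope.

(** * Expected imbalance of a random orientation *)

Lemma orientationP (V : finType) (G : rel V) (D : {set V * V}) :
  reflect ((forall j k, (j, k) \in D -> G j k) /\
           (forall j k, G j k -> ((j, k) \in D) (+) ((k, j) \in D)))
          (orientation G D).
Proof.
apply: (iffP andP) => [] [arcD xorD]; split.
- by move=> j k; apply: (forall_inP arcD (j, k)).
- by move=> j k; move/forallP: xorD => /(_ j) /forallP /(_ k) /implyP.
- by apply/forall_inP => -[j k]; apply: arcD.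
- by apply/forallP => j; apply/forallP => k; apply/implyP; apply: xorD.
Qed.

(** Expanding the product of the factors [p j k + p k j = 1] over all edges gives one term per
    orientation. *)
Lemma sum_orientation_prob (R : realType) (n : nat) (G : rel 'I_n)
    (p : 'I_n -> 'I_n -> R) :
    symmetric G -> irreflexive G ->
    (forall j k, G j k -> p j k + p k j = 1) ->
  \sum_(D : {set 'I_n * 'I_n}) orientation_prob G p D = 1.
Proof.
move=> G_sym G_irr p1.
rewrite /orientation_prob -big_mkcond /=.
pose E := [set a : 'I_n * 'I_n | G a.1 a.2 && (a.1 < a.2)%N].
pose sw (a : 'I_n * 'I_n) := (a.2, a.1).
have swK : involutive sw by case.
(* An orientation is determined by the set J of its arcs (j, k) with j < k. *)
pose h (J : {set 'I_n * 'I_n}) := J :|: [set a | sw a \in E :\: J].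
have gtE j k : G j k -> (j < k)%N = ~~ (k < j)%N.
  move=> Gjk; case: ltngtP => // /val_inj jk; move: Gjk.
  by rewrite jk G_irr.
rewrite (reindex_onto h (fun D => D :&: E)); last first.
  move=> D /orientationP [arcD xorD].
  apply/setP => -[j k]; rewrite !inE /=.
  case Djk: ((j, k) \in D) => /=.
    have Gjk := arcD _ _ Djk; have := xorD _ _ Gjk.
    rewrite Djk Gjk (G_sym k j) Gjk /= => /negbTE -> /=.
    by rewrite (gtE _ _ Gjk); case: (k < j)%N.
  case Gkj: (G k j); rewrite ?andbF //=.
  have := xorD _ _ Gkj; rewrite Djk addbF => -> /=.
  by case: (k < j)%N.
(* Pairs outside [E] get the factor [0 + 1], so that only subsets [J] of [E] survive in the
   expansion. *)
transitivity (\prod_(a : 'I_n * 'I_n)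
    ((if a \in E then p a.1 a.2 else 0) + (if a \in E then p a.2 a.1 else 1))).
  rewrite bigA_distr [RHS](bigID (fun J : {set 'I_n * 'I_n} => J \subset E)) /=.
  rewrite [RHS]addrC [X in _ = X + _]big1 ?add0r; last first.
    move=> J /subsetPn [a Ja Ea]; rewrite (bigD1 a) //= Ja (negbTE Ea).
    by rewrite mul0r.
  rewrite (eq_bigl (fun J : {set 'I_n * 'I_n} => J \subset E)) /=; last first.
    move=> J; apply/andP/idP => [[_ /eqP <-]|JE]; first exact: subsetIr.
    have JG j k : (j, k) \in J -> G j k && (j < k)%N.
      by move=> /(subsetP JE); rewrite inE.
    have JV j k : (j, k) \in J -> (k, j) \in J = false.
      move=> /JG /andP [_ jk]; apply/negP => /JG /andP [_].
      by rewrite ltnNge ltnW.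
    split.
      apply/orientationP; split => j k; rewrite !inE /=.
        by case/orP => [/JG /andP []|/and3P [_]] //; rewrite G_sym.
      move=> Gjk; rewrite (G_sym k j) Gjk /= (gtE j k Gjk).
      case Jjk: ((j, k) \in J) => /=.
        rewrite (JV _ _ Jjk) /=; move/JG: Jjk; rewrite (gtE j k Gjk) Gjk /=.
        by case: (k < j)%N.
      case Jkj: ((k, j) \in J) => //=.
      by case: (k < j)%N.
    apply/eqP/setP => -[j k]; rewrite !inE /=.
    case Jjk: ((j, k) \in J) => /=; first exact: JG.
    case Gkj: (G k j); rewrite (G_sym j k) Gkj ?andbF //=.
    by rewrite (gtE k j Gkj); case: (j < k)%N; rewrite ?andbF.
  apply: eq_bigr => J JE.
  rewrite [RHS](bigID (fun a => a \in J)) /= /h big_mkcond /=.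
  rewrite (bigID (fun a => a \in J)) /=; congr (_ * _).
    apply: eq_bigr => a Ja; rewrite inE Ja /=.
    by rewrite (subsetP JE).
  rewrite [RHS](eq_bigr (fun a => if a \in E :\: J then p a.2 a.1 else 1));
    last by move=> a nJ; rewrite in_setD (negbTE nJ).
  rewrite -!big_mkcondr /=.
  rewrite [RHS](reindex_inj (inv_inj swK)) /=; apply: eq_bigl => a.
  rewrite !inE.
  case Ja: (a \in J) => /=.
    have /(subsetP JE) := Ja; rewrite inE => /andP [_ a12].
    by rewrite /= (ltnNge a.2) (ltnW a12) !andbF.
  by case: (sw a \in J).
apply: big1 => a _; case: ifP => [|_]; last by rewrite add0r.
by rewrite inE => /andP [/p1].
Qed.

Lemma marginal_orientation_prob (R : realType) (n : nat) (G : rel 'I_n)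
    (p : 'I_n -> 'I_n -> R) (j k : 'I_n) :
    symmetric G -> irreflexive G ->
    (forall j k, G j k -> p j k + p k j = 1) -> G j k ->
  \sum_(D : {set 'I_n * 'I_n} | (j, k) \in D) orientation_prob G p D = p j k.
Proof.
move=> G_sym G_irr p1 Gjk.
have njk : (j, k) != (k, j).
  by apply: contraTneq Gjk => -[-> _]; rewrite G_irr.
pose M a := \sum_(D : {set 'I_n * 'I_n} | a \in D) orientation_prob G p D.
(* Every orientation contains exactly one of the two arcs. *)
have total : M (j, k) + M (k, j) = 1.
  rewrite -(sum_orientation_prob G_sym G_irr p1).
  rewrite [RHS](bigID (fun D : {set _} => (j, k) \in D)) /=; congr (_ + _).
  rewrite /M big_mkcond [RHS]big_mkcond; apply: eq_bigr => D _.
  rewrite /orientation_prob.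
  case: orientationP => [[_ /(_ _ _ Gjk)]|_]; last by rewrite !if_same.
  by case: (_ \in D); case: (_ \in D).
(* Reversing the arc between j and k is an involution exchanging the two
   events and changing the weight by the ratio of p j k and p k j. *)
pose sw (a : 'I_n * 'I_n) := (a.2, a.1).
have swK : involutive sw by case.
pose e := [set (j, k); (k, j)].
pose flip (D : {set 'I_n * 'I_n}) :=
  [set a | if a \in e then sw a \in D else a \in D].
have swe a : (sw a \in e) = (a \in e).
  by case: a => x y; rewrite !inE /sw /= !xpair_eqE orbC andbC [X in _ || X]andbC.
have flipK : involutive flip.
  move=> D; apply/setP => a; rewrite !inE.
  rewrite -!in_set2 -/e swe swK.
  by case: ifP => // ->.
have flip_or D : orientation G D -> orientation G (flip D).
  move=> /orientationP [arcD xorD]; apply/orientationP; split=> x y.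
    by rewrite inE; case: ifP => _ /arcD //; rewrite G_sym.
  move=> Gxy; have := xorD _ _ Gxy.
  rewrite ![_ \in flip D]inE.
  rewrite -[(y, x) \in e]swe /sw /=.
  by case: ifP => // _; rewrite addbC.
have balance : p k j * M (j, k) = p j k * M (k, j).
  rewrite /M [in RHS](reindex_inj (inv_inj flipK)) /= !big_distrr /=.
  apply: eq_big => [D|D jkD].
    by rewrite !inE eqxx orbT.
  rewrite /orientation_prob.
  have -> : orientation G (flip D) = orientation G D.
    by apply/idP/idP => /flip_or //; rewrite flipK.
  case: ifP => [/orientationP [_ /(_ _ _ Gjk)]|_]; last by rewrite !mulr0.
  rewrite jkD /= => kjD.
  rewrite (bigD1 (j, k)) //= [in RHS](bigD1 (k, j)) /=; last first.
    by rewrite !inE eqxx orbT.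
  rewrite mulrA mulrA [p k j * _]mulrC; congr (_ * _).
  apply: eq_bigl => a; rewrite !inE.
  case: (eqVneq a (j, k)) => [->|ajk] /=.
    by rewrite andbF (negbTE kjD).
  case: (eqVneq a (k, j)) => [->|akj] /=; last by [].
  by rewrite andbF (negbTE kjD).
rewrite -/(M (j, k)); have pjk := p1 _ _ Gjk.
(* Multiplying by [p j k + p k j = 1] avoids a division, as either parameter may vanish. *)
by rewrite -[LHS]mul1r -pjk mulrDl balance -mulrDr total mulr1.
Qed.

(** Linearity of expectation: the imbalance is a sum over neighbours of differences of arc
    indicators. *)
Lemma expected_imbalanceE (R : realType) (n : nat) (G : rel 'I_n)
    (p : 'I_n -> 'I_n -> R) (j : 'I_n) :
    symmetric G -> irreflexive G ->
    (forall j k, G j k -> p j k + p k j = 1) ->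
  expected_imbalance G p j = \sum_(k | G j k) (p j k - p k j).
Proof.
move=> G_sym G_irr p1.
transitivity (\sum_(D : {set 'I_n * 'I_n}) \sum_(k | G j k)
   ((if (j, k) \in D then orientation_prob G p D else 0) -
    (if (k, j) \in D then orientation_prob G p D else 0))).
  apply: eq_bigr => D _; rewrite /orientation_prob.
  case: orientationP => [[arcD _]|_]; last first.
    by rewrite mul0r big1 // => k _; rewrite !if_same subrr.
  set w := \prod_(a in D) _.
  have deg (P : pred 'I_n) : (forall k, P k -> G j k) ->
      \sum_(k | G j k) (if P k then w else 0) = w * #|[set k | P k]|%:R.
    move=> PG; rewrite -big_mkcondr /=.
    rewrite (eq_bigl (mem [set k | P k])); last first.
      by move=> k; rewrite !inE /= andbC; case Pk: (P k); rewrite //= PG.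
    by rewrite sumr_const mulr_natr.
  rewrite sumrB !deg; first by rewrite -mulrBr /imbalance rmorphB.
    by move=> k /arcD; rewrite G_sym.
  by move=> k /arcD.
rewrite exchange_big /=; apply: eq_bigr => k Gjk.
rewrite sumrB -!big_mkcond /= !marginal_orientation_prob //.
by rewrite G_sym.
Qed.

(** * The contribution of one edge: monotonicity and Lipschitz bound *)

Section Net.
Variable R : realFieldType.
Implicit Types x y z t c : R.

(** For [x = r j] and [y = r k] this is [lambda r j k - lambda r k j]. *)
Definition net x y := (x - y) / (x + y).

Lemma netC x y : net y x = - net x y.
Proof. by rewrite /net -opprB mulNr [y + x]addrC. Qed.

Lemma net_scale c x y : 0 < c -> 0 < x + y -> net (c * x) (c * y) = net x y.
Proof. by move=> c0 xy0; rewrite /net; field; rewrite -mulrDr mulf_neq0 // lt0r_neq0. Qed.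

(** After clearing the positive denominators the claim becomes [x * t <= z * y]. *)
Lemma le_net x y z t :
  0 < x -> 0 < t -> x <= z -> t <= y -> net x y <= net z t.
Proof.
move=> x0 t0 xz ty.
have xt : x * t <= z * y by apply: ler_pM => //; apply: ltW.
rewrite /net ler_pdivrMr; last by lra.
rewrite mulrAC.
rewrite ler_pdivlMr; last by lra.
lra.
Qed.

Lemma net_ltr x y z : 0 < x -> 0 < y -> y < z -> net x z < net x y.
Proof.
move=> x0 y0 yz.
have xyz : x * y < x * z by rewrite ltr_pM2l.
rewrite /net ltr_pdivrMr; last by lra.
rewrite mulrAC.
rewrite ltr_pdivlMr; last by lra.
lra.
Qed.

(** The difference quotient is at most 1 when all arguments are at least 1; this is what the lower
    end 1 of the box provides. *)
Lemma net_lip x y z : 1 <= x -> x <= z -> 1 <= y -> net z y <= net x y + (z - x).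
Proof.
move=> x1 xz y1; rewrite -lerBlDl.
have -> : net z y - net x y = (z - x) * (2 * y / ((z + y) * (x + y))).
  by rewrite /net; field; apply/andP; split; apply: lt0r_neq0; lra.
have xy : 1 * y <= x * y by rewrite ler_pM2r; lra.
have zy : 1 * y <= z * y by rewrite ler_pM2r; lra.
have zx : 0 < z * x by apply: mulr_gt0; lra.
have yy : 0 < y * y by apply: mulr_gt0; lra.
apply: ler_piMr; first by lra.
by rewrite ler_pdivrMr; [lra | apply: mulr_gt0; lra].
Qed.

End Net.

(** * Flow across a cut *)

Section Flow.
Variables (R : realFieldType) (V : finType) (G : rel V).
Hypotheses (G_sym : symmetric G) (G_irr : irreflexive G).
Implicit Types (r s : V -> R) (U : {set V}).

Definition flow r j := \sum_(k | G j k) net (r j) (r k).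

(** By antisymmetry of [net], the two contributions of an edge inside [U] cancel. *)
Lemma sum_flow r U :
  \sum_(j in U) flow r j =
  \sum_(j in U) \sum_(k | G j k && (k \notin U)) net (r j) (r k).
Proof.
pose S := \sum_(j in U) \sum_(k | G j k && (k \in U)) net (r j) (r k).
have S0 : S = 0.
  have : S = - S.
    rewrite {1}/S (exchange_big_dep (mem U)) /=; last by move=> j k _ /andP [].
    rewrite -sumrN; apply: eq_bigr => j jU; rewrite -sumrN.
    by apply: eq_big => [k|k _]; rewrite ?[G k j]G_sym ?jU ?andbT 1?andbC // netC.
  by move=> SS; lra.
rewrite -[RHS]add0r -[X in X + _]S0 -big_split; apply: eq_bigr => j _.
by rewrite /flow (bigID (mem U)).
Qed.

(** Each boundary edge is counted once, from its end in [U]. The double sum has the index set of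
    [sum_flow], which allows a comparison term by term. *)
Lemma card_boundary U :
  #|boundary G U|%:R =
  \sum_(j in U) \sum_(k | G j k && (k \notin U)) 1 :> R.
Proof.
pose A := [set a : V * V | (a.1 \in U) && (G a.1 a.2 && (a.2 \notin U))].
have -> : boundary G U = [set [set a.1; a.2] | a in A].
  have cut j k : j \in U -> k \notin U -> [set j; k] :&: U = [set j].
    move=> jU kU; apply/setP => x; rewrite !inE.
    case: (eqVneq x j) => [->|_] /=; first by rewrite jU.
    by case: (eqVneq x k) => [->|]; rewrite //= (negbTE kU).
  apply/setP => f; rewrite inE; apply/andP/imsetP; last first.
    move=> [[j k]]; rewrite inE /= => /and3P [jU Gjk kU] ->; split.
      by apply/imsetP; exists (j, k); rewrite ?inE.
    by rewrite cut // cards1.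
  case=> /imsetP [[j k]]; rewrite inE /= => Gjk -> /eqP c1.
  case jU: (j \in U); case kU: (k \in U).
  - move: c1; rewrite (setIidPl _) ?subUset ?sub1set ?jU //.
    by rewrite cards2; case: eqVneq Gjk => // ->; rewrite G_irr.
  - by exists (j, k); rewrite ?inE ?jU ?kU ?Gjk.
  - by exists (k, j); rewrite ?inE /= ?jU ?kU 1?G_sym ?Gjk // setUC.
  - move: c1; rewrite (_ : _ :&: U = set0) ?cards0 //.
    apply/setP => x; rewrite !inE; apply/negbTE/negP.
    by case/andP => /orP [] /eqP ->; rewrite ?jU ?kU.
rewrite card_in_imset; last first.
  move=> [j k] [j' k']; rewrite !inE /= => /and3P [jU _ kU] /and3P [jU' _ kU'] E.
  have : j \in [set j'; k'] by rewrite -E !inE eqxx.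
  have : k \in [set j'; k'] by rewrite -E !inE eqxx orbT.
  rewrite !inE => /orP [] /eqP kE; first by rewrite kE jU' in kU.
  case/orP => /eqP jE; last by rewrite jE (negbTE kU') in jU.
  by rewrite kE jE.
by rewrite pair_big_dep /= -sumr_const; apply: eq_bigl => a; rewrite inE.
Qed.

Lemma boundary_set0 U :
  (forall j k, j \in U -> G j k -> k \in U) -> boundary G U = set0.
Proof.
move=> Ucl; apply/eqP; rewrite -cards_eq0 -(pnatr_eq0 R) card_boundary.
apply/eqP; apply: big1 => j jU; apply: big1 => k /andP [/(Ucl _ _ jU) -> //].
Qed.

Lemma sum_flow_closed r U :
  (forall j k, j \in U -> G j k -> k \in U) -> \sum_(j in U) flow r j = 0.
Proof.
move=> Ucl; rewrite sum_flow; apply: big1 => j jU.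
by apply: big1 => k /andP [/(Ucl _ _ jU) -> //].
Qed.

End Flow.

(** * Sums, components and gaps *)

Lemma sum_le_eq (R : numDomainType) (I : finType) (A : {set I}) (f g : I -> R) :
    (forall i, i \in A -> f i <= g i) ->
    \sum_(i in A) f i = \sum_(i in A) g i ->
  forall i, i \in A -> f i = g i.
Proof.
move=> fg sum_fg i Ai; apply/eqP; rewrite eq_sym -subr_eq0; apply/eqP.
apply: (psumr_eq0P (P := mem A) (F := fun i => g i - f i)) => //.
  by move=> k /fg; rewrite subr_ge0.
by rewrite sumrB sum_fg subrr.
Qed.

Lemma component_closed (V : finType) (G : rel V) (j k l : V) :
  k \in component G j -> G k l -> l \in component G j.
Proof. by rewrite !inE => jk kl; apply: connect_trans jk (connect1 kl). Qed.

Lemma component_mem_eq (V : finType) (G : rel V) (j k : V) :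
  symmetric G -> k \in component G j -> component G k = component G j.
Proof.
move=> G_sym; rewrite inE => jk; apply/setP => l; rewrite !inE.
by rewrite (same_connect (sym_connect_sym G_sym) jk).
Qed.

Lemma not_union_of_components (V : finType) (G : rel V) (U : {set V}) (j k : V) :
    symmetric G -> connect G j k -> j \in U -> k \notin U ->
  ~ union_of_components G U.
Proof.
move=> G_sym jk jU /negP kU [S SC US]; apply: kU; move: jU.
rewrite US => /bigcupP [B BS jB]; apply/bigcupP; exists B => //.
have /imsetP [l _ Bl] := subsetP SC _ BS.
by move: jB; rewrite Bl => /(component_mem_eq G_sym) <-; rewrite inE.
Qed.

Lemma exists_small (R : realFieldType) (a c N : R) :
  0 < a -> 0 < c -> 0 <= N -> exists2 e, 0 < e & e <= a /\ N * e <= c.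
Proof.
(* The denominator is [N + 1] because [N] may be 0. *)
move=> a0 c0 N0; exists (Num.min a (c / (N + 1))).
  by rewrite lt_min a0 divr_gt0 //; lra.
split; first by rewrite ge_min lexx.
apply: (@le_trans _ _ (N * (c / (N + 1)))).
  by rewrite ler_wpM2l // ge_min lexx orbT.
rewrite mulrA ler_pdivrMr; last by lra.
by rewrite mulrC ler_wpM2l; lra.
Qed.

(* If every interval contained a value, the values would be too numerous. *)
Lemma exists_gap (R : realFieldType) (V : finType) (r : V -> R) (T : R) :
  1 < T ->
  exists2 i, (i <= #|V|)%N & forall k, r k < T ^+ i.+1 -> r k <= T ^+ i.
Proof.
move=> T1.
case: (boolP [exists i : 'I_(#|V|.+1), [forall k,
    (r k < T ^+ i.+1) ==> (r k <= T ^+ i)]]).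
  case/existsP => i /forallP gap; exists i; first by rewrite -ltnS.
  by move=> k; apply/implyP.
rewrite negb_exists => /forallP full.
have {full} : forall i : 'I_(#|V|.+1), exists k, T ^+ i < r k < T ^+ i.+1.
  move=> i; have := full i; rewrite negb_forall => /existsP [k].
  by rewrite negb_imply -ltNge => /andP [ri1 ri]; exists k; rewrite ri.
move=> /fin_all_exists [f fP].
have f_inj : injective f.
  have lt_f (i i' : 'I_(#|V|.+1)) : (i < i')%N -> f i <> f i'.
    move=> ii' ff; have /andP [_ fi] := fP i; have /andP [fi' _] := fP i'.
    have := lt_trans fi' _; rewrite -ff => /(_ _ fi).
    by rewrite ltr_eXn2l // ltnS leqNgt ii'.
  move=> i i' ff; apply: val_inj; case: (ltngtP i i') => // /lt_f; first by [].
  by move=> /(_ (esym ff)).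
by have := leq_card f f_inj; rewrite card_ord ltnn.
Qed.

(** * Existence by Perron's method *)

Section Existence.
Variables (R : realType) (V : finType) (G : rel V) (b : V -> R).
Hypotheses (G_sym : symmetric G) (G_irr : irreflexive G).

Lemma exists_box_flow (M : R) : 1 <= M ->
  exists r : V -> R, [/\ forall j, 1 <= r j <= M,
    forall j, 1 < r j -> flow G r j <= b j &
    forall j, r j < M -> b j <= flow G r j].
Proof.
move=> M1.
(* Nothing is asked of the flow where [x j = 1], so the constant 1 lies in [S] and the suprema are
   over nonempty sets. *)
pose S (x : V -> R) := (forall j, 1 <= x j <= M) /\
  (forall j, 1 < x j -> flow G x j <= b j).
pose A j : R -> Prop := fun t => exists2 x, S x & x j = t.
have supA j : classical_sets.has_sup (A j).
  split; first by exists 1, (fun=> 1); rewrite // /S ltxx lexx.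
  by exists M => t [x [/(_ j) /andP [_ ?] _] <-].
pose r j := sup (A j).
have S_le x j : S x -> x j <= r j.
  by move=> Sx; apply: sup_upper_bound => //; exists x.
have r_box j : 1 <= r j <= M.
  have [A0 _] := supA j; apply/andP; split.
    by apply: (S_le (fun=> 1)); rewrite /S ltxx lexx.
  by apply: ge_sup => // t [x [/(_ j) /andP [_ ?] _] <-].
have r1 j : 1 <= r j by case/andP: (r_box j).
pose N : R := #|V|%:R.
(* The flow out of [j] when its own value is [t] and all others are frozen at [r]. *)
pose g j t := \sum_(k | G j k) net t (r k).
have g_lip j s t : 1 <= s -> s <= t -> g j t <= g j s + N * (t - s).
  move=> s1 st; apply: (@le_trans _ _ (\sum_(k | G j k) (net s (r k) + (t - s)))).
    by apply: ler_sum => k _; apply: net_lip.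
  rewrite big_split lerD2l sumr_const /= -[leLHS]mulr_natl.
  by rewrite ler_wpM2r ?subr_ge0 // ler_nat max_card.
have r_sub j : 1 < r j -> flow G r j <= b j.
  move=> rj1; rewrite leNgt; apply/negP => b_lt.
  (* Take a member [x] of [S] with [x j] within [e] of [r j]. Raising its other coordinates to [r]
     only lowers the flow at [j], and moving [x j] up to [r j] adds at most [N * e], half of the
     supposed excess. *)
  have [||| e e0 [e_r e_b]] := @exists_small R (r j - 1) ((flow G r j - b j) / 2) N.
  - by rewrite subr_gt0.
  - by apply: divr_gt0; rewrite ?subr_gt0.
  - exact: ler0n.
  have [_ [x Sx <-] xj] := sup_adherent e0 (supA j).
  rewrite -/(r j) in xj.
  have x1 : 1 < x j by lra.
  have xb := Sx.2 j x1.
  have gx : g j (x j) <= flow G x j.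
    apply: ler_sum => k _; have := Sx.1 k => /andP [xk _].
    by apply: le_net; rewrite ?S_le //; lra.
  have gr := g_lip j _ _ (ltW x1) (S_le _ j Sx).
  have Ne : N * (r j - x j) <= N * e by rewrite ler_wpM2l ?ler0n //; lra.
  rewrite -[g j (r j)]/(flow G r j) in gr; lra.
exists r; split => // j rjM; rewrite leNgt; apply/negP => lt_b.
have [||| e e0 [e_M e_b]] := @exists_small R (M - r j) (b j - flow G r j) N.
- by rewrite subr_gt0.
- by rewrite subr_gt0.
- exact: ler0n.
(* Raising [r j] alone by [e] keeps the flow at [j] below [b j] and does not increase it elsewhere,
   so [x] is in [S], against [r] being the supremum. *)
pose x k := if k == j then r j + e else r k.
have rx k : r k <= x k by rewrite /x; case: eqVneq => // ->; lra.
suff /(S_le _ j) : S x by rewrite /x eqxx; lra.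
split=> [k|k].
  rewrite (le_trans (r1 k) (rx k)) /x; case: eqVneq => _; first by lra.
  by case/andP: (r_box k).
case: (eqVneq k j) => [->|kj] xk.
  have -> : flow G x j = g j (r j + e).
    apply: eq_bigr => l Gjl; rewrite /x eqxx; case: eqVneq Gjl => // ->.
    by rewrite G_irr.
  have := g_lip j (r j) (r j + e) (r1 j); rewrite -[g j (r j)]/(flow G r j).
  by rewrite addrAC subrr add0r => gr; have := gr _; lra.
have xkE : x k = r k by rewrite /x (negbTE kj).
apply: (le_trans _ (r_sub k _)); last by rewrite -xkE.
apply: ler_sum => l _; rewrite xkE; apply: le_net => //.
  by have := r1 k; lra.
by have := r1 l; lra.
Qed.

(** [net T 1] tends to 1 as [T] grows, and there are only finitely many sets [U]. *)
Lemma exists_threshold : exists2 T : R, 1 < T &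
  forall U : {set V}, \sum_(j in U) b j < #|boundary G U|%:R ->
  \sum_(j in U) b j < #|boundary G U|%:R * net T 1.
Proof.
pose d U : R := #|boundary G U|%:R - \sum_(j in U) b j.
(* With slack [d U], it suffices that [2 * #|boundary G U| < T * d U]; the sum of nonnegative terms
   handles all [U] at once, and the 2 gives strictness and [1 < T]. *)
pose T : R := 2 + \sum_(U | 0 < d U) 2 * #|boundary G U|%:R / d U.
have term_ge0 U : 0 < d U -> 0 <= 2 * #|boundary G U|%:R / d U.
  by move=> dU; rewrite divr_ge0 ?mulr_ge0 ?ler0n ?ltW.
have T1 : 1 < T.
  by apply: (@lt_le_trans _ _ 2); [lra | rewrite lerDl sumr_ge0].
exists T => // U; rewrite -subr_gt0 -/(d U) => dU.
have TU : 2 * #|boundary G U|%:R < T * d U.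
  rewrite -ltr_pdivrMr // /T (bigD1 U) //=.
  have : 0 <= \sum_(W | (0 < d W) && (W != U)) 2 * #|boundary G W|%:R / d W.
    by apply: sumr_ge0 => W /andP [/term_ge0].
  lra.
rewrite /net mulrA ltr_pdivlMr; last by lra.
rewrite /d in dU TU; lra.
Qed.

Lemma exists_flow :
    \sum_j b j = 0 ->
    (forall U : {set V}, \sum_(j in U) b j <= #|boundary G U|%:R) ->
    (forall U : {set V}, ~ union_of_components G U ->
      \sum_(j in U) b j < #|boundary G U|%:R) ->
  exists r : V -> R, (forall j, 0 < r j) /\ (forall j, flow G r j = b j).
Proof.
move=> b_sum b_le b_lt.
have [T T1 T_cut] := exists_threshold.
have T0 : 0 < T by lra.
pose M := T ^+ #|V|.+1.
have M1 : 1 <= M by rewrite exprn_ege1 // ltW.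
have [r [r_box r_le r_ge]] := exists_box_flow M1.
have r0 j : 0 < r j by have /andP [] := r_box j; lra.
exists r; split => // j.
pose C := component G j.
have Ccl k l : k \in C -> G k l -> l \in C by apply: component_closed.
have flowC : \sum_(k in C) flow G r k = 0 by apply: sum_flow_closed.
(* Both [C] and its complement have empty boundary, so each sum is at most 0, while the total is
   0. *)
have bC : \sum_(k in C) b k = 0.
  have closed_le (U : {set V}) : (forall k l, k \in U -> G k l -> l \in U) ->
      \sum_(k in U) b k <= 0.
    by move=> Ucl; have := b_le U; rewrite (boundary_set0 R) // cards0.
  have C_le := closed_le _ Ccl; have CC_le : \sum_(k in ~: C) b k <= 0.
    apply: closed_le => k l; rewrite !in_setC => kC Gkl.
    by apply: contra kC => /Ccl; apply; rewrite G_sym.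
  have : \sum_(k in C) b k + \sum_(k in ~: C) b k = 0.
    rewrite -[RHS]b_sum [RHS](bigID (fun k => k \in C)) /=; congr (_ + _).
    by apply: eq_bigl => k; rewrite in_setC.
  lra.
have jC : j \in C by rewrite inE connect0.
case: (boolP [forall k in C, r k < M]) => [/forall_inP below|].
  apply/esym/(@sum_le_eq _ _ C) => // [k /below /r_ge //|].
  by rewrite flowC.
rewrite negb_forall_in => /exists_inP [k1 k1C k1M].
case: (boolP [forall k in C, 1 < r k]) => [/forall_inP above|].
  apply: (@sum_le_eq _ _ C) => // [k /above /r_le //|].
  by rewrite flowC.
rewrite negb_forall_in => /exists_inP [k0 k0C k0_1].
have [i iV gap] := exists_gap r T1.
(* [U] separates [k1], where [r] is [M], from [k0], where [r] is 1; [i <= #|V|] ensures that the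
   threshold does not exceed [M]. *)
pose U := [set k in C | T ^+ i.+1 <= r k].
have Ti k : k \in U -> T ^+ i.+1 <= r k by rewrite inE => /andP [].
have k1U : k1 \in U.
  rewrite inE k1C; apply: le_trans (_ : M <= _); last by rewrite leNgt.
  by rewrite ler_eXn2l.
have k0U : k0 \notin U.
  rewrite inE k0C -ltNge /=; apply: le_lt_trans (_ : 1 < _); first by rewrite leNgt.
  by rewrite exprn_egt1.
have U_gt1 k : k \in U -> 1 < r k.
  by move=> /Ti; apply: lt_le_trans; rewrite exprn_egt1.
have k10 : connect G k1 k0.
  by move: k0C; rewrite /C -(component_mem_eq G_sym k1C) inE.
have := T_cut U (b_lt U (not_union_of_components G_sym k10 k1U k0U)).
rewrite ltNge => /negP []; apply: le_trans (_ : \sum_(k in U) flow G r k <= _).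
  rewrite sum_flow // card_boundary // mulr_suml; apply: ler_sum => k kU.
  rewrite mulr_suml; apply: ler_sum => l /andP [Gkl lU]; rewrite mul1r.
  have Ti0 : 0 < T ^+ i by rewrite exprn_gt0.
  (* Rescaled by [T ^+ i], the bound compares [T ^+ i.+1 <= r k] and [r l <= T ^+ i], the latter by
     the gap. *)
  rewrite -(net_scale Ti0); last by lra.
  apply: le_net => //; first by rewrite mulr_gt0.
    by rewrite -exprSr Ti.
  rewrite mulr1 gap // ltNge; apply: contra lU => lT; rewrite inE lT andbT.
  by apply: Ccl Gkl; move: kU; rewrite inE => /andP [].
by apply: ler_sum => k /U_gt1 /r_le.
Qed.

End Existence.

(** * Uniqueness by the maximum principle *)

Section Uniqueness.
Variables (R : realFieldType) (V : finType) (G : rel V) (r s : V -> R).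
Hypothesis G_sym : symmetric G.
Hypotheses (r_gt0 : forall j, 0 < r j) (s_gt0 : forall j, 0 < s j).
Hypothesis flow_eq : forall j, flow G r j = flow G s j.

Lemma flow_unique (j : V) :
  exists2 c : R, 0 < c & forall k, connect G j k -> s k = c * r k.
Proof.
have := @arg_maxP _ _ _ j (connect G j) (fun k => s k / r k) (connect0 G j).
(* [c] is the largest ratio [s / r] on the component; equality at [m] is to be spread along
   paths. *)
case=> m jm m_max; pose c := s m / r m.
have c0 : 0 < c by rewrite divr_gt0.
exists c => // k jk.
have s_le l : connect G j l -> s l <= c * r l.
  by move=> jl; rewrite -ler_pdivrMr //; apply: m_max.
have step l l' : connect G j l -> s l = c * r l -> G l l' -> s l' = c * r l'.
  move=> jl sl Gll'; apply/eqP; rewrite eq_le s_le /=; last first.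
    exact: connect_trans jl (connect1 Gll').
  (* Where [s l = c * r l], each edge term for [r] is at most that for [s]; the sums agree, hence so
     do all terms. *)
  have le_term k' : G l k' -> net (r l) (r k') <= net (s l) (s k').
    move=> Glk'; rewrite -(net_scale c0) ?addr_gt0 // sl.
    apply: le_net => //; first by rewrite mulr_gt0.
    exact: s_le (connect_trans jl (connect1 Glk')).
  have := @sum_le_eq _ _ [set k' | G l k'] (fun k' => net (r l) (r k'))
    (fun k' => net (s l) (s k')) _ _ l'.
  have sumE t : \sum_(i in [set k' | G l k']) net (t l) (t i) = flow G t l.
    by apply: eq_bigl => i; rewrite inE.
  rewrite !sumE inE => /(_ _ (flow_eq l) Gll') net_eq.
  rewrite leNgt; apply/negP => sl'.
  (* A strict inequality at [l'] would make the term of [s] strictly larger. *)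
  have := @net_ltr _ (s l) (s l') (c * r l') (s_gt0 l) (s_gt0 l') sl'.
  rewrite {1}sl net_scale ?addr_gt0 // net_eq ?ltxx // => k'.
  by rewrite inE; apply: le_term.
have: connect G m k.
  by apply: connect_trans jk; rewrite (sym_connect_sym G_sym).
have sm : s m = c * r m by rewrite /c divfK // gt_eqF.
case/connectP => p + -> => {k jk}.
elim: p {m_max} (m) jm sm => [//|l p IH] x jx sx /= /andP [Gxl pl].
by apply: IH => //; [exact: connect_trans jx (connect1 Gxl) | exact: step Gxl].
Qed.

End Uniqueness.

(** * From flows back to random orientations *)

Lemma lambdaD (R : realType) (n : nat) (r : 'rV[R]_n) (j k : 'I_n) :
  (forall j, 0 < r 0 j) -> lambda r j k + lambda r k j = 1.
Proof.
move=> r0; rewrite /lambda [r 0 k + _]addrC -mulrDl divff //.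
by rewrite gt_eqF // addr_gt0.
Qed.

Lemma expected_imbalance_lambda (R : realType) (n : nat) (G : rel 'I_n)
    (r : 'rV[R]_n) (j : 'I_n) :
    symmetric G -> irreflexive G -> (forall j, 0 < r 0 j) ->
  expected_imbalance G (lambda r) j = flow G (r 0) j.
Proof.
move=> G_sym G_irr r0; rewrite expected_imbalanceE //; last first.
  by move=> k l _; apply: lambdaD.
by apply: eq_bigr => k _; rewrite /lambda [r 0 k + _]addrC -mulrBl.
Qed.

Theorem theorem7 (R : realType) (n : nat) (G : rel 'I_n)
    (G_sym : symmetric G) (G_irr : irreflexive G) (b : 'rV[R]_n)
    (b_sum : \sum_(j < n) b 0 j = 0)
    (b_le : forall U : {set 'I_n},
        \sum_(j in U) b 0 j <= #|boundary G U|%:R)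
    (b_lt : forall U : {set 'I_n}, ~ union_of_components G U ->
        \sum_(j in U) b 0 j < #|boundary G U|%:R) :
  exists r : 'rV[R]_n,
    realizes G b r /\
    (forall s : 'rV[R]_n, realizes G b s ->
       forall C : {set 'I_n}, C \in components G ->
       exists2 c : R, 0 < c & forall j, j \in C -> s 0 j = c * r 0 j).
Proof.
have [r [r0 rb]] := exists_flow G_sym G_irr b_sum b_le b_lt.
pose v : 'rV[R]_n := \row_j r j.
have v0 j : 0 < v 0 j by rewrite mxE.
have vb j : flow G (v 0) j = b 0 j.
  by rewrite -rb /flow mxE; apply: eq_bigr => k _; rewrite mxE.
exists v; split.
  by split=> // j; rewrite expected_imbalance_lambda.
move=> s [s0 sb] C /imsetP [j _ ->].
have sv k : flow G (v 0) k = flow G (s 0) k.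
  by rewrite vb -sb expected_imbalance_lambda.
have [c c0 cP] := flow_unique G_sym v0 s0 sv j.
by exists c => // k; rewrite inE => /cP.
Qed.
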